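(* Let $\tilde A_i=(a_i;\,l_i^{\mu L},r_i^{\mu L},l_i^{\mu U},r_i^{\mu U};\,l_i^{\nu L},r_i^{\nu L},l_i^{\nu U},r_i^{\nu U})_{LR}$, $i=1,2$, be $LR$-type IVIFNs with the same shape functions, where $a_1<0$ and $a_1+r_1^{\mu L}\ge0$, and $\tilde A_2$ is arbitrary. Then $\tilde A_1\odot\tilde A_2=(a;\,l^{\mu L},r^{\mu L},l^{\mu U},r^{\mu U};\,l^{\nu L},r^{\nu L},l^{\nu U},r^{\nu U})_{LR}$, where $a=a_1a_2$ and, for each $\kappa\in\{\mu L,\mu U,\nu L,\nu U\}$, $$l^\kappa=a_1a_2-\min\{(a_1-l_1^\kappa)(a_2+r_2^\kappa),(a_1+r_1^\kappa)(a_2-l_2^\kappa)\},\quad r^\kappa=\max\{(a_1+r_1^\kappa)(a_2+r_2^\kappa),(a_1-l_1^\kappa)(a_2-l_2^\kappa)\}-a_1a_2.$$ Moreover the conditions for an $LR$-type representation hold: all eight spreads of the product are positive and $l^{\mu U}\ge l^{\mu L}$, $l^{\nu L}\ge l^{\nu U}$, $l^{\nu L}\ge l^{\mu L}$, $l^{\nu U}\ge l^{\mu U}$, and likewise with $r$ in place of $l$.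
   Context: A shape function is a continuous, strictly decreasing, invertible $f:[0,\infty)\to[0,1]$ with $f(0)=1$ and $\lim_{x\to\infty}f(x)=0$. Fix shape functions $L,R,L',R'$. An $LR$-type interval-valued intuitionistic fuzzy number (IVIFN) is written $\tilde A=(a;l^{\mu L},r^{\mu L},l^{\mu U},r^{\mu U};l^{\nu L},r^{\nu L},l^{\nu U},r^{\nu U})_{LR}$, where $a\in\mathbb R$ is its mean value and the eight spreads are positive reals with $l^{\mu U}\ge l^{\mu L}$, $r^{\mu U}\ge r^{\mu L}$, $l^{\nu L}\ge l^{\nu U}$, $r^{\nu L}\ge r^{\nu U}$, $l^{\nu L}\ge l^{\mu L}$, $r^{\nu L}\ge r^{\mu L}$, $l^{\nu U}\ge l^{\mu U}$, $r^{\nu U}\ge r^{\mu U}$. It encodes a lower membership function equal to $L((a-x)/l^{\mu L})$ on $[a-l^{\mu L},a]$, $R((x-a)/r^{\mu L})$ on $[a,a+r^{\mu L}]$, and $0$ otherwise; an upper membership function of the same form with $L',R',l^{\mu U},r^{\mu U}$; a lower non-membership function equal to $1-L((a-x)/l^{\nu L})$ on $[a-l^{\nu L},a]$, $1-R((x-a)/r^{\nu L})$ on $[a,a+r^{\nu L}]$, and $1$ otherwise; and an upper non-membership function of the same form with $L',R',l^{\nu U},r^{\nu U}$. At each $x$ the supremum of the membership interval plus the supremum of the non-membership interval is at most $1$. The product $\tilde A_1\odot\tilde A_2$ is formed cutwise by interval multiplication and read off at the level where the inverse shape functions equal $0$ (giving the mean) and at the level where they equal $1$ (giving the spreads). That is,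 it is the tuple (with the same shape functions) with mean $a=a_1a_2$ and spreads determined, for each $\kappa\in\{\mu L,\mu U,\nu L,\nu U\}$, by $$[a-l^{\kappa},a+r^{\kappa}]=[a_1-l_1^{\kappa},a_1+r_1^{\kappa}]\times[a_2-l_2^{\kappa},a_2+r_2^{\kappa}],$$ where $I\times J=\{xy:x\in I,y\in J\}$. *)

(* Defs.v *)
From HB Require Import structures.
From mathcomp Require Import all_boot all_order all_algebra.
From mathcomp Require Import all_classical all_reals all_analysis.
Set Implicit Arguments.
Unset Strict Implicit.
Unset Printing Implicit Defensive.
Import Order.TTheory GRing.Theory Num.Theory.
Import numFieldNormedType.Exports.
Local Open Scope classical_set_scope.
Local Open Scope ring_scope.

(* A shape function lives on [0, +oo[; values of f on negative reals are
   irrelevant.  A strictly decreasing nonnegative f on [0, +oo[ never takes the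
   value 0, so "invertible" can only mean invertible onto the range of f. *)
Definition is_shape (R : realType) (f : R -> R) : Prop :=
  [/\ set_fun `[0, +oo[ `[0, 1] f,
      {within `[0, +oo[, continuous f},
      {in `[0, +oo[ &, forall x y, x < y -> f y < f x},
      set_bij `[0, +oo[ (f @` `[0, +oo[) f &
      f 0 = 1 /\ f x @[x --> +oo] --> (0 : R)].

(* muL, muU: lower and upper membership; nuL, nuU: lower and upper
   non-membership. *)
Inductive kappa : Type := muL | muU | nuL | nuU.

Record LRtuple (R : realType) : Type := LRTuple {
  mean : R;
  lspread : kappa -> R;
  rspread : kappa -> R }.

Definition membership (R : realType) (fL fR : R -> R) (a l r x : R) : R :=
  if a - l <= x <= a then fL ((a - x) / l)
  else if a <= x <= a + r then fR ((x - a) / r)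
  else 0.

Definition nonmembership (R : realType) (fL fR : R -> R) (a l r x : R) : R :=
  if a - l <= x <= a then 1 - fL ((a - x) / l)
  else if a <= x <= a + r then 1 - fR ((x - a) / r)
  else 1.

Definition lower_membership (R : realType) (fL fR : R -> R) (A : LRtuple R) :
  R -> R := membership fL fR (mean A) (lspread A muL) (rspread A muL).
Definition upper_membership (R : realType) (fL' fR' : R -> R) (A : LRtuple R) :
  R -> R := membership fL' fR' (mean A) (lspread A muU) (rspread A muU).
Definition lower_nonmembership (R : realType) (fL fR : R -> R) (A : LRtuple R) :
  R -> R := nonmembership fL fR (mean A) (lspread A nuL) (rspread A nuL).
Definition upper_nonmembership (R : realType) (fL' fR' : R -> R)
  (A : LRtuple R) :
  R -> R := nonmembership fL' fR' (mean A) (lspread A nuU) (rspread A nuU).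

Definition membership_itv (R : realType) (fL fR fL' fR' : R -> R)
    (A : LRtuple R) (x : R) : set R :=
  `[lower_membership fL fR A x, upper_membership fL' fR' A x].
Definition nonmembership_itv (R : realType) (fL fR fL' fR' : R -> R)
    (A : LRtuple R) (x : R) : set R :=
  `[lower_nonmembership fL fR A x, upper_nonmembership fL' fR' A x].

Definition spread_order (R : realType) (s : kappa -> R) : Prop :=
  [/\ s muL <= s muU, s nuU <= s nuL, s muL <= s nuL & s muU <= s nuU].

Definition LR_conditions (R : realType) (A : LRtuple R) : Prop :=
  [/\ forall k, 0 < lspread A k,
      forall k, 0 < rspread A k,
      spread_order (lspread A) &
      spread_order (rspread A)].

(* No relation between (fL, fR) and (fL', fR') is imposed, so at some x a lower
   value may exceed the upper one; that interval is then empty, of supremum 0. *)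
Definition is_IVIFN (R : realType) (fL fR fL' fR' : R -> R) (A : LRtuple R) :
  Prop :=
  LR_conditions A /\
  forall x, sup (membership_itv fL fR fL' fR' A x)
            + sup (nonmembership_itv fL fR fL' fR' A x) <= 1.

Definition cut (R : realType) (A : LRtuple R) (k : kappa) : set R :=
  `[mean A - lspread A k, mean A + rspread A k].

(* The equality of intervals determines the spreads of the product A, which is
   therefore rendered as a relation rather than as a function of A1 and A2. *)
Definition is_product (R : realType) (A1 A2 A : LRtuple R) : Prop :=
  mean A = mean A1 * mean A2 /\
  forall k, cut A k = [set x * y | x in cut A1 k & y in cut A2 k].

(* Main.v *)
(* When p1 <= 0 <= q1, the four corner products of [p1, q1] x [p2, q2] have
   minimum min (p1 q2) (q1 p2) and maximum max (q1 q2) (p1 p2).  The corner of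
   the minimum and that of the maximum always share a side of the rectangle, so
   every intermediate value is already a product on that side.  Monotonicity of
   the product spreads is monotonicity of interval multiplication for inclusion,
   and the bound on membership plus non-membership follows from the ordering of
   the upper spreads alone. *)
Require Import Defs.
From HB Require Import structures.
From mathcomp Require Import all_boot all_order all_algebra.
From mathcomp Require Import all_classical all_reals all_analysis.
Import Order.TTheory GRing.Theory Num.Theory.
Import numFieldNormedType.Exports.
Local Open Scope classical_set_scope.
Local Open Scope ring_scope.

(** Used to move along one side of a rectangle. For [c] nonzero the witness is [z / c]; if the order
    of the bounds disagrees with the sign of [c], they force [u = v], and the witness still lies in
    between. *)
Lemma scale_itv_surj (R : realFieldType) (c u v z : R) : u <= v ->
  (c * u <= z <= c * v) || (c * v <= z <= c * u) ->
  exists2 y, u <= y <= v & c * y = z.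
Proof.
move=> uv; have [->|c0] := eqVneq c 0.
  rewrite !mul0r orbb => /le_anti <-; exists u; rewrite ?mul0r //.
  by rewrite lexx.
move=> hz; exists (z / c); last by rewrite mulrCA divff ?mulr1.
have e : z = c * (z / c) by rewrite mulrCA divff ?mulr1.
move: hz; rewrite {1 2 3 4}e; set y := z / c.
have [cn|cp] : c < 0 \/ 0 < c by apply/orP; rewrite -neq_lt.
  rewrite !(ler_nM2l cn) => /orP[/andP[a b]|/andP[-> ->]//].
  by rewrite (le_trans uv b) (le_trans a uv).
rewrite !(ler_pM2l cp) => /orP[/andP[-> ->]//|/andP[a b]].
by rewrite (le_trans uv a) (le_trans b uv).
Qed.

Section ItvProduct.
Variables (R : realType) (p1 q1 : R).
Hypotheses (p1_le0 : p1 <= 0) (q1_ge0 : 0 <= q1).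

Lemma itv_product (p2 q2 : R) : p2 <= q2 ->
  [set x * y | x in `[p1, q1] & y in `[p2, q2]] =
  `[Num.min (p1 * q2) (q1 * p2), Num.max (q1 * q2) (p1 * p2)]%classic.
Proof.
move=> pq2; have pq1 : p1 <= q1 by exact: le_trans q1_ge0.
apply/seteqP; split => z /=.
  case=> x + [y + <-]; rewrite /= !in_itv /= => /andP[px xq] /andP[py yq].
  (* The signs of [x] and [y] give the sign of [x * y]. On one side [0] separates [x * y] from a
     corner product; on the other, monotonicity in each factor leads to a corner. *)
  rewrite ge_min le_max; have [x0|/ltW x0] := leP 0 x;
    have [y0|/ltW y0] := leP 0 y.
  - have q20 := le_trans y0 yq.
    by rewrite (le_trans (mulr_le0_ge0 p1_le0 q20) (mulr_ge0 x0 y0)) /= ler_pM.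
  - have p20 := le_trans py y0.
    rewrite (le_trans (ler_wpM2l q1_ge0 py) (ler_wnM2r y0 xq)) orbT /=.
    by rewrite (le_trans (mulr_ge0_le0 x0 y0) (mulr_le0 p1_le0 p20)) orbT.
  - have q20 := le_trans y0 yq.
    rewrite (le_trans (ler_wnM2l p1_le0 yq) (ler_wpM2r y0 px)) /=.
    by rewrite (le_trans (mulr_le0_ge0 x0 y0) (mulr_ge0 q1_ge0 q20)).
  - have p20 := le_trans py y0.
    rewrite (le_trans (mulr_ge0_le0 q1_ge0 p20) (mulr_le0 x0 y0)) orbT /=.
    by rewrite (le_trans (ler_wnM2r y0 px) (ler_wnM2l p1_le0 py)) orbT.
rewrite in_itv /= ge_min le_max => /andP[/orP[] lo /orP[] hi].
(* The side shared by the two corners is, in order: [y = q2], [x = p1], [x = q1], [y = p2]. *)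
- have [|x hx <-] := scale_itv_surj R q2 p1 q1 z pq1.
    by rewrite ![q2 * _]mulrC lo hi.
  exists x; rewrite /= ?in_itv //.
  by exists q2; rewrite /= ?in_itv /= ?pq2 ?lexx // mulrC.
- have [|y hy <-] := scale_itv_surj R p1 p2 q2 z pq2.
    by rewrite lo hi orbT.
  by exists p1; rewrite /= ?in_itv /= ?lexx //; exists y; rewrite /= ?in_itv.
- have [|y hy <-] := scale_itv_surj R q1 p2 q2 z pq2.
    by rewrite lo hi.
  exists q1; rewrite /= ?in_itv /= ?lexx ?pq1 //.
  by exists y; rewrite /= ?in_itv.
- have [|x hx <-] := scale_itv_surj R p2 p1 q1 z pq1.
    by rewrite ![p2 * _]mulrC lo hi orbT.
  exists x; rewrite /= ?in_itv //.
  by exists p2; rewrite /= ?in_itv /= ?pq2 ?lexx // mulrC.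
Qed.

(** If [0 <= a2], then [p1 * q2 < a1 * q2 < a1 * a2]; otherwise [q1 * p2 <= 0 < a1 * a2]. The value
    [a2 = 0] belongs to the first case, because [q1 * p2] vanishes when [q1 = 0]. *)
Lemma itv_product_min_lt (a1 a2 p2 q2 : R) :
  p1 < a1 -> a1 < 0 -> p2 < a2 -> a2 < q2 ->
  Num.min (p1 * q2) (q1 * p2) < a1 * a2.
Proof.
move=> pa1 a10 pa2 aq2; rewrite gt_min; have [a20|a20] := leP 0 a2.
  have q20 := le_lt_trans a20 aq2.
  by rewrite (@lt_trans _ _ (a1 * q2)) ?ltr_pM2r ?ltr_nM2l.
have p20 := ltW (lt_trans pa2 a20).
by rewrite orbC (le_lt_trans (mulr_ge0_le0 q1_ge0 p20)) // nmulr_rgt0.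
Qed.

(** If [0 < a2], then [a1 * a2 < 0 <= q1 * q2]; otherwise [a1 * a2 <= p1 * a2 < p1 * p2], which is
    strict even at [a2 = 0]. *)
Lemma itv_product_max_gt (a1 a2 p2 q2 : R) :
  p1 < a1 -> a1 < 0 -> p2 < a2 -> a2 < q2 ->
  a1 * a2 < Num.max (q1 * q2) (p1 * p2).
Proof.
move=> pa1 a10 pa2 aq2; rewrite lt_max; have [a20|a20] := ltP 0 a2.
  have q20 := ltW (lt_trans a20 aq2).
  by rewrite (lt_le_trans _ (mulr_ge0 q1_ge0 q20)) // nmulr_rlt0.
have p10 := lt_trans pa1 a10.
by rewrite orbC (le_lt_trans (ler_wnM2r a20 (ltW pa1))) // ltr_nM2l.
Qed.

End ItvProduct.

Lemma subset_itvcc (R : realType) (a b c d : R) : a <= b ->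
  `[a, b] `<=` `[c, d] -> c <= a /\ b <= d.
Proof.
move=> ab s; have := s a; have := s b.
rewrite /= !in_itv /= !lexx ab => /(_ isT)/andP[_ bd] /(_ isT)/andP[ca _].
by split.
Qed.

Lemma itvcc_inj (R : realType) (a b c d : R) : c <= d ->
  `[a, b]%classic = `[c, d]%classic -> a = c /\ b = d.
Proof.
move=> cd e.
(* This inclusion also shows [a <= b], which the reverse inclusion requires. *)
have [ac db] : a <= c /\ d <= b by apply: subset_itvcc => //; rewrite e.
have [ca bd] : c <= a /\ b <= d.
  by apply: subset_itvcc; [exact: le_trans (le_trans cd db)|rewrite e].
by split; apply: le_anti; rewrite ?ac ?ca ?bd ?db.
Qed.

(** The sign of [b] covers the empty interval, whose [sup] is [0]. *)
Lemma sup_itvcc_le (R : realType) (a b : R) : 0 <= b -> sup `[a, b] <= b.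
Proof.
move=> b0; have [ab|ba] := leP a b.
  apply: ge_sup; first by exists a; rewrite /= in_itv /= lexx.
  by move=> x; rewrite /= in_itv /= => /andP[].
by rewrite set_itv_ge ?sup0 // bnd_simp -ltNge.
Qed.

Section Shapes.
Variables (R : realType) (fL fR : R -> R).
Hypotheses (hL : is_shape fL) (hR : is_shape fR).

Lemma shape_itv (f : R -> R) (x : R) : is_shape f -> 0 <= x -> 0 <= f x <= 1.
Proof.
case=> h _ _ _ _ x0; have := h x; rewrite /= !in_itv /= andbT; exact.
Qed.

Lemma shape_nincr (f : R -> R) (x y : R) : is_shape f ->
  0 <= x -> x <= y -> f y <= f x.
Proof.
case=> _ _ h _ _ x0; rewrite le_eqVlt => /predU1P[->//|xy].
by apply/ltW/h; rewrite ?in_itv /= ?andbT // (le_trans x0 (ltW xy)).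
Qed.

Lemma membership_itv01 (a l r x : R) : 0 < l -> 0 < r ->
  0 <= membership fL fR a l r x <= 1.
Proof.
move=> l0 r0; rewrite /membership; case: ifP => [/andP[_ xa]|_].
  by apply: shape_itv => //; rewrite divr_ge0 ?subr_ge0// ltW.
case: ifP => [/andP[ax _]|_]; last by rewrite lexx ler01.
by apply: shape_itv => //; rewrite divr_ge0 ?subr_ge0// ltW.
Qed.

Lemma nonmembershipE (a l r x : R) :
  nonmembership fL fR a l r x = 1 - membership fL fR a l r x.
Proof.
by rewrite /nonmembership /membership; do 2?case: ifP => // _; rewrite subr0.
Qed.

(** A larger spread lowers the quotient at which the decreasing shape function is evaluated. Outside
    the narrower support the left-hand side is [0]. *)
Lemma membership_le (a l r l' r' x : R) :
  0 < l -> 0 < r -> l <= l' -> r <= r' ->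
  membership fL fR a l r x <= membership fL fR a l' r' x.
Proof.
move=> l0 r0 ll rr.
have l0' := lt_le_trans l0 ll; have r0' := lt_le_trans r0 rr.
have /andP[+ _] := membership_itv01 a l' r' x l0' r0'.
have div_le (t u v : R) : 0 <= t -> 0 < u -> u <= v -> t / v <= t / u.
  by move=> t0 u0 uv; rewrite ler_wpM2l // lef_pV2 // posrE (lt_le_trans u0).
rewrite [membership _ _ a l r x]/membership; case: ifP => [/andP[h xa]|_].
  move=> _; rewrite /membership xa (le_trans _ h) ?lerB //=.
  have xa0 : 0 <= a - x by rewrite subr_ge0.
  by apply: shape_nincr; rewrite ?div_le ?divr_ge0// ltW.
case: ifP => // /andP[ax h] _.
(* At [x = a] the wider function takes its left branch while the narrower one is here on its right
   branch; both shape functions equal [1] at [0]. *)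
have [xa|xa] := leP x a.
  have -> : x = a by apply/le_anti; rewrite ax xa.
  rewrite /membership lexx gerBl (ltW l0') /= subrr !mul0r.
  by case: hL => _ _ _ _ [-> _]; case: hR => _ _ _ _ [-> _].
rewrite /membership [x <= a]leNgt xa andbF ax (le_trans h) ?lerD //=.
have xa0 : 0 <= x - a by rewrite subr_ge0.
by apply: shape_nincr; rewrite ?div_le ?divr_ge0// ltW.
Qed.

End Shapes.

(** Each supremum is at most the upper value. The upper non-membership is [1] minus a membership
    function with the spreads [nuU], which dominates the one with the spreads [muU]. *)
Lemma LR_conditions_IVIFN (R : realType) (fL fR fL' fR' : R -> R)
    (A : LRtuple R) : is_shape fL' -> is_shape fR' ->
  LR_conditions A -> is_IVIFN fL fR fL' fR' A.
Proof.
move=> hL' hR' hA; split=> // x.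
have [l0 r0 [_ _ _ lU] [_ _ _ rU]] := hA.
have mle := membership_le _ _ _ hL' hR' (mean A) _ _ _ _ x
  (l0 muU) (r0 muU) lU rU.
have /andP[m0 _] := membership_itv01 _ _ _ hL' hR' (mean A) _ _ x
  (l0 muU) (r0 muU).
have /andP[_ n1] := membership_itv01 _ _ _ hL' hR' (mean A) _ _ x
  (l0 nuU) (r0 nuU).
apply: (@le_trans _ _ (upper_membership fL' fR' A x
                       + upper_nonmembership fL' fR' A x)).
  apply: lerD; apply: sup_itvcc_le => //.
  by rewrite /upper_nonmembership nonmembershipE subr_ge0.
by rewrite /upper_nonmembership nonmembershipE addrCA gerDl subr_le0.
Qed.

Lemma spread_order_le (R : realType) (s : kappa -> R) (k : kappa) :
  spread_order s -> s muL <= s k.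
Proof. by case=> h1 h2 h3 h4; case: k => //; exact: le_trans h4. Qed.

Theorem proposition3p1p7 (R : realType) (fL fR fL' fR' : R -> R)
    (hL : is_shape fL) (hR : is_shape fR)
    (hL' : is_shape fL') (hR' : is_shape fR')
    (A1 A2 : LRtuple R)
    (hA1 : is_IVIFN fL fR fL' fR' A1) (hA2 : is_IVIFN fL fR fL' fR' A2)
    (ha1 : mean A1 < 0) (har1 : 0 <= mean A1 + rspread A1 muL) :
  let a1 := mean A1 in let l1 := lspread A1 in let r1 := rspread A1 in
  let a2 := mean A2 in let l2 := lspread A2 in let r2 := rspread A2 in
  let P := LRTuple (a1 * a2)
    (fun k => a1 * a2 - Num.min ((a1 - l1 k) * (a2 + r2 k))
                                ((a1 + r1 k) * (a2 - l2 k)))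
    (fun k => Num.max ((a1 + r1 k) * (a2 + r2 k))
                      ((a1 - l1 k) * (a2 - l2 k)) - a1 * a2) in
  [/\ forall A : LRtuple R, is_product A1 A2 A <-> A = P,
      LR_conditions P &
      is_IVIFN fL fR fL' fR' P].
Proof.
move=> a1 l1 r1 a2 l2 r2 P.
have [[l10 r10 ol1 or1] _] := hA1; have [[l20 r20 ol2 or2] _] := hA2.
have p1a k : a1 - l1 k < a1 by rewrite ltrBlDr ltrDl.
have p2a k : a2 - l2 k < a2 by rewrite ltrBlDr ltrDl.
have aq2 k : a2 < a2 + r2 k by rewrite ltrDl.
have p10 k : a1 - l1 k <= 0 := ltW (lt_trans (p1a k) ha1).
(* The spread at [muL] is the smallest, so [har1] extends to every [k]. *)
have q10 k : 0 <= a1 + r1 k.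
  by apply: le_trans har1 _; rewrite lerD2l; exact: spread_order_le.
have minP k : Num.min ((a1 - l1 k) * (a2 + r2 k)) ((a1 + r1 k) * (a2 - l2 k))
    < a1 * a2 by exact: itv_product_min_lt.
have maxP k : a1 * a2 <
    Num.max ((a1 + r1 k) * (a2 + r2 k)) ((a1 - l1 k) * (a2 - l2 k)).
  exact: itv_product_max_gt.
have prodE k : [set x * y | x in Defs.cut A1 k & y in Defs.cut A2 k] =
    `[Num.min ((a1 - l1 k) * (a2 + r2 k)) ((a1 + r1 k) * (a2 - l2 k)),
      Num.max ((a1 + r1 k) * (a2 + r2 k)) ((a1 - l1 k) * (a2 - l2 k))]%classic.
  by apply: itv_product => //; exact: ltW (lt_trans (p2a k) (aq2 k)).
have cutS (A : LRtuple R) j k : lspread A j <= lspread A k ->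
    rspread A j <= rspread A k -> Defs.cut A j `<=` Defs.cut A k.
  by move=> lle rle; apply: subset_itvScc; rewrite bnd_simp ?lerD2l ?lerN2.
have mono j k : l1 j <= l1 k -> r1 j <= r1 k -> l2 j <= l2 k -> r2 j <= r2 k ->
    lspread P j <= lspread P k /\ rspread P j <= rspread P k.
  move=> hl1 hr1 hl2 hr2; rewrite /= !lerD2l !lerD2r lerN2.
  (* With [a1 * a2] cancelled, the goal compares endpoints of two product intervals, hence reduces
     to their inclusion. *)
  apply: subset_itvcc; first exact: ltW (lt_trans (minP j) (maxP j)).
  rewrite -!prodE => _ [x hx [y hy <-]].
  exists x; first exact: (cutS A1 j k).
  by exists y => //; exact: (cutS A2 j k).
have LRP : LR_conditions P.
  case: ol1 ol2 or1 or2 => a b c d [a' b' c' d'] [e f g h] [e' f' g' h'].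
  have [x1 y1] := mono _ _ a e a' e'; have [x2 y2] := mono _ _ b f b' f'.
  have [x3 y3] := mono _ _ c g c' g'; have [x4 y4] := mono _ _ d h d' h'.
  by split=> // k; rewrite /= subr_gt0.
split=> //; last exact: LR_conditions_IVIFN.
have minmax k := ltW (lt_trans (minP k) (maxP k)).
move=> A; split=> [[eqm eqc]|->].
  have lrE k : lspread A k = lspread P k /\ rspread A k = rspread P k.
    (* The spreads of [A] may have any sign a priori, so nonemptiness is supplied for the explicit
       interval. Its endpoints and the mean then fix both spreads. *)
    have [el er] := itvcc_inj _ _ _ _ _ (minmax k) (etrans (eqc k) (prodE k)).
    by rewrite /= -el -er eqm subKr addrC addKr.
  case: A eqm {eqc} lrE => m l r /= -> lrE.
  by congr LRTuple; apply/funext => k; have [] := lrE k.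
by split=> // k; rewrite prodE /Defs.cut /= subKr subrKC.
Qed.
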